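(* Let $\vdash$ be an algebraizable logic with equivalent algebraic semantics the quasivariety $\mathbf{Y}$, and let $f$ be a selector term. The map $\mathsf{QVar}^f$ is a dual isomorphism between the complete lattices $\Lambda^f(\vdash)$ and $\Xi^f(\mathbf{Y})$.
   Context: Let $\mathcal{L}$ be an algebraic language, $\mathsf{Prop}$ a fixed countably infinite set of variables, $Tm(\mathcal{L},\mathsf{Prop})$ the set of terms (formulas). A consequence relation on a set $C$ is a relation between subsets and elements of $C$ that is reflexive ($W\vdash a$ if $a\in W$) and satisfies cut (if $W\vdash v$ for all $v\in V$ and $V\vdash a$ then $W\vdash a$); all consequence relations are assumed finitary (if $W\vdash a$ then $V\vdash a$ for some finite $V\subseteq W$). A logic is a substitution-invariant consequence relation on $Tm(\mathcal{L},\mathsf{Prop})$. $\Lambda(\vdash)$ is the complete lattice of (finitary) logics extending $\vdash$. A quasivariety is a class of algebras closed under isomorphisms, subalgebras and reduced products; $\Xi(\mathbf{Y})$ is the lattice of subquasivarieties of $\mathbf{Y}$. For a class $\mathbf{K}$, $\Theta\vDash_{\mathbf{K}}\gamma\approx\delta$ means that every assignment into an algebra of $\mathbf{K}$ satisfying all equations in $\Theta$ satisfies $\gamma\approx\delta$. The logic $\vdash$ is algebraizable with equivalent algebraic semantics the quasivariety $\mathbf{Y}$ (of language $\mathcal{L}$), witnessed by a finite set $\mu(x)$ of equations in one variable and a finite set $\Delta(x,y)$ of formulas in two variables: (1) $\Gamma\vdash\phi$ iff $\mu[\Gamma]\vDash_{\mathbf{Y}}\mu(\phi)$; (2) $\Theta\vDash_{\mathbf{Y}}\gamma\approx\delta$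 iff $\Delta[\Theta]\vdash\Delta(\gamma,\delta)$; (3) $\phi\dashv\vdash\Delta[\mu(\phi)]$; (4) $\gamma\approx\delta$ and $\mu[\Delta(\gamma,\delta)]$ are $\vDash_{\mathbf{Y}}$-interderivable. Here $\mu[\Gamma]$ is the union of the sets $\mu(\psi)$ for $\psi\in\Gamma$, and $\Delta[\Theta]$ is the union of the sets $\Delta(\varepsilon,\upsilon)$ for $\varepsilon\approx\upsilon$ in $\Theta$. A unary term $f(x)$ of $\mathcal{L}$ is a selector term if it is idempotent, i.e. $f(f(x))\dashv\vdash f(x)$ (each of $f(f(x))$ and $f(x)$ is derivable from the other in $\vdash$). $\chi[f(\overline p)/\overline p]$ is the result of substituting $f(q)$ for each variable $q$ in $\chi$, and $\Gamma[f(\overline p)/\overline p]$ is defined elementwise. For $\vdash_*\in\Lambda(\vdash)$, $\vdash_*^f$ is defined by $\Gamma\vdash_*^f\phi$ iff $\Gamma[f(\overline p)/\overline p]\vdash_*\phi[f(\overline p)/\overline p]$. $\Lambda^f(\vdash)=\{\vdash_*^f:\ \vdash_*\in\Lambda(\vdash)\}$, the $\mathsf{PAt}$-$f$-logics ordered by inclusion (a complete lattice). For $\mathcal{A}\in\mathbf{Y}$, $\mathcal{A}^f=\{a\in A:f(a)=a\}$. For $\mathcal{A},\mathcal{B}\in\mathbf{Y}$, $\mathcal{B}\preceq_f\mathcal{A}$ ($\mathcal{A}$ is a core superalgebra of $\mathcal{B}$) means $\mathcal{B}$ is a subalgebra of $\mathcal{A}$ and $\mathcal{A}^f=\mathcal{B}^f$.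 For $\mathbf{K}\in\Xi(\mathbf{Y})$, $\mathbf{K}^\uparrow=\{\mathcal{A}\in\mathbf{Y}:\exists\mathcal{B}\in\mathbf{K},\ \mathcal{B}\preceq_f\mathcal{A}\}$. $\Xi^f(\mathbf{Y})=\{\mathbf{K}^\uparrow:\mathbf{K}\in\Xi(\mathbf{Y})\}$, the $\mathsf{PAt}$-$f$-quasivarieties ordered by inclusion (a complete lattice). $\mathcal{A}\vDash_f(\Gamma,\phi)$ means: for each $v:\mathsf{Prop}\to\mathcal{A}^f$, if $\mathcal{A},v\vDash\mu[\Gamma]$ then $\mathcal{A},v\vDash\mu(\phi)$. $\mathsf{QVar}^f(\vdash_s)=\{\mathcal{A}\in\mathbf{Y}:\mathcal{A}\vDash_f(\Gamma,\phi)\text{ for all }(\Gamma,\phi)\in{\vdash_s}\}$.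
   Formalization: The selector term f is assumed idempotent on the algebras of Y, i.e. Y satisfies f(f(x)) ≈ f(x), not only f(f(x)) ⊣⊢ f(x); with interderivability alone the claim fails (abelian ℓ-groups, x designated when x ≥ 0, f(x) = 2|x|). *)

(* Defs.v *)
From mathcomp Require Import all_boot.
From mathcomp Require Import boolp classical_sets functions cardinality filter.

Set Implicit Arguments.
Unset Strict Implicit.
Unset Printing Implicit Defensive.

Local Open Scope classical_set_scope.

(* Classes of algebras are plain predicates [algebra L -> Prop], and the
   carrier of a reduced product is built from plain predicates: using the
   (universe-monomorphic) type [set] at both levels would be inconsistent. *)

(** * Terms and algebras *)

Record language := Language { symbol : Type; arity : symbol -> nat }.

Inductive term (L : language) (X : Type) : Type :=
| Var of X
| App (o : symbol L) of ('I_(arity o) -> term L X).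
Arguments Var {L X}.
Arguments App {L X}.

Fixpoint tsubst (L : language) (X Z : Type) (s : X -> term L Z)
    (t : term L X) : term L Z :=
  match t with
  | Var x => s x
  | App o ts => App o (fun k => tsubst s (ts k))
  end.

Definition equation (L : language) (X : Type) : Type :=
  (term L X * term L X)%type.

Definition esubst (L : language) (X Z : Type) (s : X -> term L Z)
    (e : equation L X) : equation L Z := (tsubst s e.1, tsubst s e.2).

(* The fixed countably infinite set of variables is [nat]. *)
Definition formula (L : language) : Type := term L nat.

Record algebra (L : language) := Algebra {
  carrier :> Type;
  op : forall o : symbol L, ('I_(arity o) -> carrier) -> carrier;
  carrier_nonempty : inhabited carrier
}.

Fixpoint eval (L : language) (A : algebra L) (X : Type) (v : X -> A)
    (t : term L X) : A :=
  match t with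
  | Var x => v x
  | App o ts => op (fun k => eval v (ts k))
  end.

Definition holds (L : language) (A : algebra L) (X : Type) (v : X -> A)
    (e : equation L X) : Prop := eval v e.1 = eval v e.2.

Definition holds_all (L : language) (A : algebra L) (X : Type) (v : X -> A)
    (E : set (equation L X)) : Prop := forall e, E e -> holds v e.

Definition models (L : language) (K : algebra L -> Prop)
    (Theta : set (equation L nat)) (e : equation L nat) : Prop :=
  forall A : algebra L, K A ->
  forall v : nat -> A, holds_all v Theta -> holds v e.

(** * Isomorphisms, subalgebras, reduced products, quasivarieties *)

Definition is_hom (L : language) (A B : algebra L) (h : A -> B) : Prop :=
  forall (o : symbol L) (a : 'I_(arity o) -> A),
    h (op a) = op (fun k => h (a k)).

Definition isomorphic (L : language) (A B : algebra L) : Prop :=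
  exists2 h : A -> B, is_hom h & bijective h.

Record subuniverse (L : language) (A : algebra L) := Subuniverse {
  insub_univ :> A -> Prop;
  subuniverse_nonempty : exists a, insub_univ a;
  subuniverse_closed : forall (o : symbol L) (a : 'I_(arity o) -> A),
    (forall k, insub_univ (a k)) -> insub_univ (op a)
}.

Section Subalgebra.
Variables (L : language) (A : algebra L) (S : subuniverse A).

Definition sub_op (o : symbol L) (a : 'I_(arity o) -> {x : A | S x}) :
    {x : A | S x} :=
  exist _ (op (fun k => sval (a k)))
    (subuniverse_closed (fun k => proj2_sig (a k))).

Lemma sub_nonempty : inhabited {x : A | S x}.
Proof. by case: (subuniverse_nonempty S) => a Sa; exists; exists a. Qed.

Definition subalgebra : algebra L := Algebra sub_op sub_nonempty.
End Subalgebra.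

Section ReducedProduct.
Variables (L : language) (I : Type) (A : I -> algebra L).
Variable F : set_system I.

Definition rp_class (a : forall i, A i) : (forall i, A i) -> Prop :=
  fun b => F [set i | a i = b i].

Definition rp_carrier : Type :=
  {C : (forall i, A i) -> Prop | exists a, C = rp_class a}.

Definition rp_pi (a : forall i, A i) : rp_carrier :=
  exist _ (rp_class a) (ex_intro _ a erefl).

Definition rp_repr (c : rp_carrier) : forall i, A i :=
  projT1 (cid (proj2_sig c)).

Definition rp_op (o : symbol L) (c : 'I_(arity o) -> rp_carrier) : rp_carrier :=
  rp_pi (fun i => op (fun k => rp_repr (c k) i)).

Lemma rp_nonempty : inhabited rp_carrier.
Proof.
exists; apply: rp_pi => i.
have [a _] : {a : A i | True} by apply: cid; case: (carrier_nonempty (A i)) => a; exists a.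
exact: a.
Qed.

Definition reduced_product : algebra L := Algebra rp_op rp_nonempty.
End ReducedProduct.
Arguments rp_class {L I} A F.
Arguments rp_pi {L I} A F.
Arguments rp_repr {L I A F}.

(* [Filter] does not require properness, so the empty family is allowed and
   every quasivariety contains the trivial algebras. *)
Definition is_quasivariety (L : language) (K : algebra L -> Prop) : Prop :=
  [/\ forall A B : algebra L, isomorphic A B -> K A -> K B,
      forall (A : algebra L) (S : subuniverse A), K A -> K (subalgebra S)
    & forall (I : Type) (A : I -> algebra L) (F : set_system I),
        Filter F -> (forall i, K (A i)) -> K (reduced_product A F)].

Definition Xi (L : language) (Y K : algebra L -> Prop) : Prop :=
  is_quasivariety K /\ (forall A, K A -> Y A).

(** * Logics *)

Definition conseq (L : language) : Type := set (formula L) -> formula L -> Prop.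

Record is_consequence (L : language) (r : conseq L) : Prop := {
  conseq_refl : forall W a, W a -> r W a;
  conseq_cut : forall W V a, (forall v, V v -> r W v) -> r V a -> r W a;
  conseq_finitary : forall W a, r W a ->
    exists V, [/\ finite_set V, V `<=` W & r V a]
}.

Record is_logic (L : language) (r : conseq L) : Prop := {
  logic_consequence : is_consequence r;
  logic_subst : forall (s : nat -> formula L) W a,
    r W a -> r (tsubst s @` W) (tsubst s a)
}.

Definition conseq_le (L : language) (r s : conseq L) : Prop :=
  forall W a, r W a -> s W a.

Definition Lambda (L : language) (r s : conseq L) : Prop :=
  is_logic s /\ conseq_le r s.

Definition derives_all (L : language) (r : conseq L)
    (W V : set (formula L)) : Prop := forall a, V a -> r W a.

Definition interderivable (L : language) (r : conseq L)
    (W V : set (formula L)) : Prop := derives_all r W V /\ derives_all r V W.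

(** * Algebraizability *)

Section Algebraizable.
Variable L : language.
(* Equations in the single variable [tt], and formulas in the two variables
   [true] (for x) and [false] (for y). *)
Variables (mu : set (equation L unit)) (Delta : set (term L bool)).

Definition mu_at (phi : formula L) : set (equation L nat) :=
  esubst (fun=> phi) @` mu.

Definition mu_img (Gamma : set (formula L)) : set (equation L nat) :=
  \bigcup_(psi in Gamma) mu_at psi.

Definition Delta_at (gamma delta : formula L) : set (formula L) :=
  tsubst (fun b : bool => if b then gamma else delta) @` Delta.

Definition Delta_img (Theta : set (equation L nat)) : set (formula L) :=
  \bigcup_(e in Theta) Delta_at e.1 e.2.

Definition models_all (K : algebra L -> Prop)
    (Theta E : set (equation L nat)) : Prop := forall e, E e -> models K Theta e.

Record algebraizable (r : conseq L) (Y : algebra L -> Prop) : Prop := {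
  alg_mu_finite : finite_set mu;
  alg_Delta_finite : finite_set Delta;
  alg_logic : forall Gamma phi,
    r Gamma phi <-> models_all Y (mu_img Gamma) (mu_at phi);
  alg_equation : forall Theta gamma delta,
    models Y Theta (gamma, delta) <->
    derives_all r (Delta_img Theta) (Delta_at gamma delta);
  alg_formula_inv : forall phi,
    interderivable r [set phi] (Delta_img (mu_at phi));
  alg_equation_inv : forall gamma delta,
    models_all Y [set (gamma, delta)] (mu_img (Delta_at gamma delta)) /\
    models Y (mu_img (Delta_at gamma delta)) (gamma, delta)
}.
End Algebraizable.

(** * Selector terms and polyatomic logics *)

Section Selector.
Variables (L : language) (f : term L unit).

Definition tapp (X : Type) (t : term L X) : term L X := tsubst (fun=> t) f.

Definition aapp (A : algebra L) (a : A) : A := eval (fun=> a) f.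

Definition selector_term (r : conseq L) : Prop :=
  forall x : nat,
    interderivable r [set tapp (tapp (Var x))] [set tapp (Var x)].

(* Stronger than [selector_term].  In abelian l-groups, with designated
   elements x >= 0, both f(x) = 2|x| and f(f(x)) = 4|x| are theorems, hence
   interderivable, but Y does not satisfy f(f(x)) = f(x). *)
Definition idempotent_in (Y : algebra L -> Prop) : Prop :=
  forall x : nat, models Y set0 (tapp (tapp (Var x)), tapp (Var x)).

Definition fsubst (phi : formula L) : formula L :=
  tsubst (fun q => tapp (Var q)) phi.

Definition conseq_f (r : conseq L) : conseq L :=
  fun Gamma phi => r (fsubst @` Gamma) (fsubst phi).

Definition Lambda_f (r s : conseq L) : Prop :=
  exists2 t, Lambda r t & s = conseq_f t.

Definition core (A : algebra L) (a : A) : Prop := aapp a = a.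

(* A^f = B^f for the subalgebra B of A with universe S, both cores being
   regarded as subsets of A. *)
Definition core_superalgebra (A : algebra L) (S : subuniverse A) : Prop :=
  forall a : A,
    core a <-> exists2 b : subalgebra S, core b & a = sval b.

Definition up (Y K : algebra L -> Prop) : algebra L -> Prop :=
  fun A => Y A /\
    exists S : subuniverse A, K (subalgebra S) /\ core_superalgebra S.

Definition Xi_f (Y U : algebra L -> Prop) : Prop :=
  exists2 K, Xi Y K & U = up Y K.

Definition models_f (mu : set (equation L unit)) (A : algebra L)
    (Gamma : set (formula L)) (phi : formula L) : Prop :=
  forall v : nat -> A, (forall p, core (v p)) ->
    holds_all v (mu_img mu Gamma) -> holds_all v (mu_at mu phi).

Definition QVar_f (mu : set (equation L unit)) (Y : algebra L -> Prop)
    (s : conseq L) : algebra L -> Prop :=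
  fun A => Y A /\ forall Gamma phi, s Gamma phi -> models_f mu A Gamma phi.
End Selector.

Definition class_le (L : language) (K M : algebra L -> Prop) : Prop :=
  forall A, K A -> M A.

(** * Complete lattices carried by a predicate on a type *)

Section Lattice.
Variables (T : Type) (le : T -> T -> Prop) (D : T -> Prop).

Definition partial_order_on : Prop :=
  [/\ forall x, D x -> le x x,
      forall x y, D x -> D y -> le x y -> le y x -> x = y
    & forall x y z, D x -> D y -> D z -> le x y -> le y z -> le x z].

Definition is_glb (X : T -> Prop) (m : T) : Prop :=
  [/\ D m, forall x, X x -> le m x
    & forall z, D z -> (forall x, X x -> le z x) -> le z m].

Definition is_lub (X : T -> Prop) (m : T) : Prop :=
  [/\ D m, forall x, X x -> le x m
    & forall z, D z -> (forall x, X x -> le x z) -> le m z].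

Definition complete_lattice_on : Prop :=
  partial_order_on /\
  forall X : T -> Prop, (forall x, X x -> D x) ->
    (exists m, is_glb X m) /\ (exists m, is_lub X m).
End Lattice.

Definition dual_isomorphism (S T : Type) (leS : S -> S -> Prop)
    (leT : T -> T -> Prop) (D : S -> Prop) (E : T -> Prop) (h : S -> T) : Prop :=
  [/\ forall x, D x -> E (h x),
      forall x y, D x -> D y -> h x = h y -> x = y,
      forall z, E z -> exists2 x, D x & h x = z
    & forall x y, D x -> D y -> (leS x y <-> leT (h y) (h x))].

(* Main.v *)
(* Write QVar for the class of models in Y of a logic, and A* for the
   subalgebra of A generated by the core A^f.  Algebraizability makes QVar a
   dual isomorphism from the logics extending |- to the subquasivarieties of Y:
   the quasivariety theorem of Maltsev recovers a quasivariety from its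
   quasi-equations, and Lindenbaum algebras recover a logic from its models.
   For K a quasivariety, A lies in the upward closure of K iff A* lies in K;
   since every element of A* is the value of a term at core elements, structural
   invariance of a logic s yields QVar^f(s^f) = QVar(s)^up.  Conversely, for v an
   assignment into a model of s, the value at v of a formula with f(p)
   substituted for each p is its value at the core assignment f o v, so
   QVar^f(s^f) determines s^f.
   Suprema and infima come from intersecting subquasivarieties. *)

Require Import Defs.
From mathcomp Require Import all_boot.
From mathcomp Require Import boolp classical_sets functions cardinality filter.

Set Implicit Arguments.
Unset Strict Implicit.
Unset Printing Implicit Defensive.

Local Open Scope classical_set_scope.

(** * Evaluation, substitution and homomorphisms *)

Lemma eval_tsubst (L : language) (A : algebra L) (X Z : Type) (v : Z -> A)
    (s : X -> term L Z) (t : term L X) :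
  eval v (tsubst s t) = eval (fun x => eval v (s x)) t.
Proof.
elim: t => //= o ts IH; congr op; exact: funext.
Qed.

Lemma holds_esubst (L : language) (A : algebra L) (X Z : Type) (v : Z -> A)
    (s : X -> term L Z) (e : equation L X) :
  holds v (esubst s e) = holds (fun x => eval v (s x)) e.
Proof. by rewrite /holds /= !eval_tsubst. Qed.

Lemma eval_hom (L : language) (A B : algebra L) (h : A -> B) (X : Type)
    (v : X -> A) (t : term L X) :
  is_hom h -> h (eval v t) = eval (fun x => h (v x)) t.
Proof.
move=> hh; elim: t => //= o ts IH; rewrite hh; congr op; exact: funext.
Qed.

Lemma is_hom_sval (L : language) (A : algebra L) (S : subuniverse A) :
  is_hom (fun x : subalgebra S => sval x : A).
Proof. by []. Qed.

Lemma sval_inj_sub (L : language) (A : algebra L) (S : subuniverse A) :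
  injective (fun x : subalgebra S => sval x : A).
Proof. by case=> [x Sx] [y Sy] /= xy; apply: eq_exist. Qed.

Lemma eval_closed (L : language) (A : algebra L) (S : subuniverse A)
    (X : Type) (v : X -> A) (t : term L X) :
  (forall x, S (v x)) -> S (eval v t).
Proof.
move=> Sv; elim: t => //= o ts IH; exact: subuniverse_closed.
Qed.

Lemma holds_all_hom (L : language) (A B : algebra L) (h : A -> B) (X : Type)
    (v : X -> A) (E : set (equation L X)) :
  is_hom h -> injective h ->
  holds_all (fun x => h (v x)) E <-> holds_all v E.
Proof.
move=> hh hi; split=> H e Ee; have := H e Ee;
  rewrite /holds -!(eval_hom _ _ hh).
  exact: hi.
by move=> ->.
Qed.

Lemma inj_surj_bijective (T U : Type) (h : T -> U) :
  injective h -> (forall u, exists t, h t = u) -> bijective h.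
Proof.
move=> hi hs; have [g gK] := choice hs.
by exists g => // t; apply: hi; rewrite gK.
Qed.

(** * Quasivarieties *)

Section Quasivariety.
Variables (L : language) (K : algebra L -> Prop).
Hypothesis qK : is_quasivariety K.

(** The image of [h] is a subuniverse of [B], and choosing preimages makes its subalgebra isomorphic
    to [A]. *)
Lemma quasivariety_embedding (A B : algebra L) (h : A -> B) :
  is_hom h -> injective h -> K B -> K A.
Proof.
have [Kiso Ksub _] := qK; move=> hh hi KB.
have ne : exists b, exists a, h a = b.
  by case: (carrier_nonempty A) => a; exists (h a), a.
have cl (o : symbol L) (b : 'I_(arity o) -> B) :
    (forall k, exists a, h a = b k) -> exists a, h a = op b.
  move=> /choice[a ha]; exists (op a); rewrite hh; congr op; exact: funext.
pose S := Subuniverse ne cl.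
apply: (Kiso (subalgebra S)); last exact: Ksub.
have hS (x : subalgebra S) : exists a, h a = sval x by case: x.
have [g hg] := choice hS.
exists g.
  move=> o x; apply: hi; rewrite hg hh /=; congr op.
  by apply: funext => k; rewrite hg.
apply: inj_surj_bijective => [x y gxy|a].
  by apply: sval_inj_sub; rewrite -!hg gxy.
have Sa : S (h a) by exists a.
by exists (exist _ (h a) Sa); apply: hi; rewrite hg.
Qed.

Lemma quasivariety_sub (A : algebra L) (S T : subuniverse A) :
  (forall a, S a -> T a) -> K (subalgebra T) -> K (subalgebra S).
Proof.
move=> ST.
pose h (x : subalgebra S) : subalgebra T :=
  exist _ (sval x) (ST _ (proj2_sig x)).
apply: (@quasivariety_embedding _ _ h).
  by move=> o x; apply: eq_exist.
by move=> x y hxy; apply: sval_inj_sub; have := congr1 sval hxy.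
Qed.

End Quasivariety.

(** * Reduced products and compactness *)

Lemma filter_finite (T I : Type) (F : set_system T) (D : set I)
    (P : I -> set T) :
  Filter F -> finite_set D -> (forall i, D i -> F (P i)) ->
  F [set x | forall i, D i -> P i x].
Proof.
(* Classical choice gives [I] the choice structure that [finite_fsetP] needs. *)
elim/Pchoice: I => I in D P *.
move=> FF /finite_fsetP[E ->] FP.
by apply: filterS (filter_bigI FF FP) => x Px i iE; apply: Px.
Qed.

Section ReducedProducts.
Variables (L : language) (I : Type) (A : I -> algebra L) (F : set_system I).
Hypothesis FF : Filter F.

Lemma rp_piP (a b : forall i, A i) :
  rp_pi A F a = rp_pi A F b <-> F [set i | a i = b i].
Proof.
split=> [/(congr1 sval) /= ab|ab].
  suff: rp_class A F b b by rewrite -ab.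
  by apply: filterS filterT.
apply: eq_exist; apply: funext => c; apply: propext; split=> Fc.
  by apply: filterS (filterI ab Fc) => i [/= -> ->].
by apply: filterS (filterI ab Fc) => i [/= -> ->].
Qed.

Lemma rp_reprK (c : reduced_product A F) : rp_pi A F (rp_repr c) = c.
Proof.
case: c => C hC; apply: eq_exist.
by rewrite /rp_repr /=; case: cid.
Qed.

(** Operations act on chosen representatives. For each of the finitely many arguments these agree
    with the given ones on a member of [F], and [F] contains the intersection of these members. *)
Lemma eval_rp (X : Type) (v : X -> forall i, A i) (t : term L X) :
  eval (fun x => rp_pi A F (v x) : reduced_product A F) t =
  rp_pi A F (fun i => eval (fun x => v x i) t).
Proof.
elim: t => //= o ts IH; apply/rp_piP.
suff: F [set i | forall k,
    rp_repr (rp_pi A F (fun i => eval (fun x => v x i) (ts k))) i =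
    eval (fun x => v x i) (ts k)].
  apply: filterS => i /= Hi; congr op; apply: funext => k.
  by rewrite IH; exact: Hi.
apply: filter_forall => k.
by apply/rp_piP; rewrite rp_reprK.
Qed.

Lemma holds_rp (X : Type) (v : X -> forall i, A i) (e : equation L X) :
  holds (fun x => rp_pi A F (v x) : reduced_product A F) e <->
  F [set i | holds (fun x => v x i) e].
Proof. by rewrite /holds !eval_rp; exact: rp_piP. Qed.

End ReducedProducts.

(** Unlike [models], this allows any type of variables: the diagram of an algebra uses its elements
    as variables. *)
Definition entails (L : language) (K : algebra L -> Prop) (X : Type)
    (Theta E : set (equation L X)) : Prop :=
  forall A : algebra L, K A -> forall v : X -> A,
    holds_all v Theta -> holds_all v E.

(** If every finite [V] fails, choose a counterexample for each and take the reduced product over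
    the filter generated by the cones of sets above a given [V]. Each equation of [Theta] holds on a
    cone, hence in the product. So [E] holds there too and, being finite, holds in a single factor,
    a contradiction. *)
Lemma entails_compact (L : language) (K : algebra L -> Prop) (X : Type)
    (Theta E : set (equation L X)) :
  is_quasivariety K -> finite_set E -> entails K Theta E ->
  exists V, [/\ finite_set V, V `<=` Theta & entails K V E].
Proof.
move=> [_ _ Krp] finE KE; apply: contrapT => noV.
(* [equation L X -> Prop] instead of [set _] keeps the universe of [set] out of
   the carrier of the reduced product. *)
pose I := {V : equation L X -> Prop | finite_set V /\ V `<=` Theta}.
pose mk (V : equation L X -> Prop) (fV : finite_set V) (VT : V `<=` Theta) : I
  := exist _ V (conj fV VT).
have cex (i : I) : exists w : {A : algebra L & X -> A},
    [/\ K (projT1 w), holds_all (projT2 w) (sval i)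
      & ~ holds_all (projT2 w) E].
  apply: contrapT => noA; apply: noV; exists (sval i).
  case: i noA => V [finV VT] noA; split=> // A KA v vV.
  by apply: contrapT => vE; apply: noA; exists (existT _ A v).
have [w hw] := choice cex.
pose A i := projT1 (w i).
pose F : set_system I := fun P => exists i0 : I,
  forall i, sval i0 `<=` sval i -> P i.
have FF : Filter F.
  split.
  - by exists (mk set0 (finite_set0 _) (sub0set _)).
  - move=> P Q [[V [fV VT]] VP] [[W [fW WT]] WQ].
    have fVW : finite_set (V `|` W) by rewrite finite_setU.
    have VWT : V `|` W `<=` Theta by move=> e [/VT|/WT].
    exists (mk _ fVW VWT) => i /= sub; split.
      by apply: VP => e Ve; apply: sub; left.
    by apply: WQ => e Ve; apply: sub; right.
  - by move=> P Q PQ [V VP]; exists V => i /VP /PQ.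
pose v (x : X) (i : I) : A i := projT2 (w i) x.
have RE : holds_all (fun x => rp_pi A F (v x) : reduced_product A F) E.
  apply: KE => [|e Te].
    by apply: Krp => i; case: (hw i).
  apply/holds_rp.
  have eT : [set e] `<=` Theta by move=> _ ->.
  exists (mk _ (finite_set1 e) eT) => i /= sub; case: (hw i) => _ + _; apply.
  exact: sub.
have : F [set i | forall e, E e -> holds (fun x => v x i) e].
  by apply: filter_finite => // e Ee; apply/holds_rp; apply: RE.
case=> i0 /(_ i0) Hi0; case: (hw i0) => _ _; apply.
exact: Hi0.
Qed.

(** * Axiomatization by quasi-equations *)

Fixpoint term_vars (L : language) (X : Type) (t : term L X) : set X :=
  match t with
  | Var x => [set x]
  | App o ts => \bigcup_k term_vars (ts k)
  end.

Lemma finite_term_vars (L : language) (X : Type) (t : term L X) :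
  finite_set (term_vars t).
Proof.
elim: t => [x|o ts IH] /=; first exact: finite_set1.
by apply: bigcup_finite => // k _; apply: IH.
Qed.

Lemma eq_eval (L : language) (A : algebra L) (X : Type) (v w : X -> A)
    (t : term L X) :
  (forall x, term_vars t x -> v x = w x) -> eval v t = eval w t.
Proof.
elim: t => [x|o ts IH] /= vw; first exact: vw.
by congr op; apply: funext => k; apply: IH => x xt; apply: vw; exists k.
Qed.

Definition eq_vars (L : language) (X : Type) (e : equation L X) : set X :=
  term_vars e.1 `|` term_vars e.2.

Lemma eq_holds (L : language) (A : algebra L) (X : Type) (v w : X -> A)
    (e : equation L X) :
  (forall x, eq_vars e x -> v x = w x) -> holds v e -> holds w e.
Proof.
move=> vw; rewrite /holds.
by rewrite !(@eq_eval _ _ _ v w) // => x xe; apply: vw; [right|left].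
Qed.

(** Used to code elements of an algebra, taken as variables, by numbers, since [models] has
    variables in [nat] only; [x0] is a junk value. *)
Lemma countable_section (T : Type) (W : set T) (x0 : T) : countable W ->
  exists (r : T -> nat) (s : nat -> T), forall x, W x -> s (r x) = x.
Proof.
move=> /countable_injP[r ri].
have /choice[s hs] (n : nat) :
    exists y, (exists2 x, W x & r x = n) -> W y /\ r y = n.
  case: (pselect (exists2 x, W x & r x = n)) => [[x Wx rx]|no].
    by exists x.
  by exists x0.
exists r, s => x Wx; have [] := hs (r x); first by exists x.
by move=> Wy /ri; apply; rewrite ?inE.
Qed.

(* Maltsev: the quasi-equations in countably many variables that are true in
   [K] axiomatize [K].  For [a <> b], compactness applied to the diagram of
   [A] yields a homomorphism into a member of [K] that separates [a] from [b],
   so [A] embeds into a direct product of members of [K]. *)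
Lemma quasivariety_axiomatized (L : language) (K : algebra L -> Prop)
    (A : algebra L) :
  is_quasivariety K ->
  (forall Theta e, models K Theta e ->
     forall v : nat -> A, holds_all v Theta -> holds v e) ->
  K A.
Proof.
move=> qK AK.
pose diag : set (equation L A) := [set e | holds id e].
have sep (p : {p : A * A | p.1 <> p.2}) :
    exists w : {B : algebra L & A -> B},
    [/\ K (projT1 w), is_hom (projT2 w)
      & projT2 w (sval p).1 <> projT2 w (sval p).2].
  case: p => -[a b] /= ab.
  (* A failure of this entailment is a valuation satisfying the diagram, that is, a homomorphism on
     [A] separating [a] from [b]. *)
  have : ~ entails K diag [set (Var a, Var b)].
    move=> /(entails_compact qK (finite_set1 _))[V [finV Vdiag KV]].
    pose W := \bigcup_(e in V) eq_vars e `|` [set a; b].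
    have cW : countable W.
      apply: finite_set_countable; rewrite /W !finite_setU; split; last first.
        by split; exact: finite_set1.
      apply: bigcup_finite => // e _; rewrite finite_setU.
      by split; exact: finite_term_vars.
    have [r [s rs]] := countable_section a cW.
    apply: ab; rewrite -(rs a); last by right; left.
    rewrite -[RHS](rs b); last by right; right.
    (* Renamed by [r], the entailment is a quasi-equation of [K], hence true in [A]; the valuation
       [s] undoes the renaming. *)
    apply: (AK (esubst (fun x => Var (r x)) @` V) (Var (r a), Var (r b))).
      move=> B KB w wV.
      apply: (KV B KB (fun x => w (r x)) _ (Var a, Var b)) => // e Ve.
      have := wV _ (imageP _ Ve); by rewrite holds_esubst.
    move=> _ [e Ve <-]; rewrite holds_esubst /=.
    apply: (@eq_holds _ _ _ id) (Vdiag e Ve) => x xe.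
    by rewrite rs //; left; exists e.
  move=> nK; apply: contrapT => now; apply: nK => B KB h hdiag _ ->.
  rewrite /holds /=; apply: contrapT => hab; apply: now.
  exists (existT _ B h); split=> //= o x.
  have -> // : h (op x) = op (fun k => h (x k)).
  exact: (hdiag (Var (op x), App o (fun k => Var (x k)))).
have [w hw] := choice sep.
(* With the full index set as its only member, [F] turns the reduced product into a direct
   product. *)
pose B p := projT1 (w p); pose F := [set [set: {p : A * A | p.1 <> p.2}]].
have FF : Filter F.
  split=> //.
    by move=> P Q -> ->; rewrite /F /= setIT.
  by move=> P Q PQ P1; apply/seteqP; split=> // p _; apply: PQ; rewrite P1.
pose h (a : A) : reduced_product B F := rp_pi B F (fun p => projT2 (w p) a).
apply: (@quasivariety_embedding _ _ qK _ (reduced_product B F) h).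
- move=> o x; rewrite /h.
  have -> : (fun p => projT2 (w p) (op x)) =
            (fun p => op (fun k => projT2 (w p) (x k))).
    by apply: functional_extensionality_dep => p; case: (hw p).
  exact: esym (eval_rp FF (fun k p => projT2 (w p) (x k))
                 (App o (fun k => Var k))).
- move=> a b /(rp_piP FF) Fab; apply: contrapT => ab.
  have [_ _] := hw (exist _ (a, b) ab); apply.
  have : [set: {p : A * A | p.1 <> p.2}] (exist _ (a, b) ab) by [].
  by rewrite -Fab.
- by case: qK => _ _; apply => // p; case: (hw p).
Qed.

(** * Logics and subquasivarieties *)

Section FormalQuotient.
Variables (L : language) (theta : formula L -> formula L -> Prop).
Hypothesis theta_refl : forall a, theta a a.
Hypothesis theta_sym : forall a b, theta a b -> theta b a.
Hypothesis theta_trans : forall a b c, theta a b -> theta b c -> theta a c.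
Hypothesis theta_app : forall (o : symbol L) (a b : 'I_(arity o) -> formula L),
  (forall k, theta (a k) (b k)) -> theta (App o a) (App o b).

Definition fq_carrier : Type :=
  {C : formula L -> Prop | exists a, C = theta a}.

Definition fq_pi (a : formula L) : fq_carrier :=
  exist _ (theta a) (ex_intro _ a erefl).

Definition fq_repr (c : fq_carrier) : formula L := sval (cid (proj2_sig c)).

(** The operations act on chosen representatives; [theta_app] makes the choice irrelevant. *)
Definition formal_quotient : algebra L :=
  @Algebra L fq_carrier (fun o c => fq_pi (App o (fun k => fq_repr (c k))))
    (inhabits (fq_pi (Var 0))).

Lemma fq_piP (a b : formula L) : fq_pi a = fq_pi b <-> theta a b.
Proof.
split=> [/(congr1 sval) /= ->|ab]; first exact: theta_refl.
apply: eq_exist; apply: funext => c; apply: propext; split.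
  exact: theta_trans (theta_sym ab).
exact: theta_trans ab.
Qed.

Lemma fq_reprK (c : formal_quotient) : fq_pi (fq_repr c) = c.
Proof.
by case: c => C hC; apply: eq_exist; rewrite /fq_repr; case: cid.
Qed.

Lemma eval_fq (X : Type) (s : X -> formula L) (t : term L X) :
  eval (fun x => fq_pi (s x) : formal_quotient) t = fq_pi (tsubst s t).
Proof.
elim: t => //= o ts IH; apply/fq_piP; apply: theta_app => k.
by apply/fq_piP; rewrite fq_reprK IH.
Qed.

End FormalQuotient.

Lemma tsubst_comp (L : language) (X Z W : Type) (r : Z -> term L W)
    (s : X -> term L Z) (t : term L X) :
  tsubst r (tsubst s t) = tsubst (fun x => tsubst r (s x)) t.
Proof. by elim: t => //= o ts IH; congr App; apply: funext. Qed.

Lemma tsubst_Var (L : language) (X : Type) (t : term L X) : tsubst Var t = t.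
Proof. by elim: t => //= o ts IH; congr App; apply: funext. Qed.

(** One index is chosen per element of [V]; [i0] serves outside [V]. *)
Lemma finite_bigcup_sub (T I : Type) (i0 : I) (V : set T) (D : set I)
    (P : I -> set T) :
  finite_set V -> V `<=` \bigcup_(i in D) P i ->
  exists D0, [/\ finite_set D0, D0 `<=` D & V `<=` \bigcup_(i in D0) P i].
Proof.
move=> fV VP.
have /choice[g hg] (x : T) : exists i, V x -> D i /\ P i x.
  case: (pselect (V x)) => [/VP[i Di Pix]|nV]; first by exists i.
  by exists i0.
exists (g @` V); split; first exact: finite_image.
  by move=> _ [x /hg[] + _ <-].
by move=> x Vx; exists (g x); [exact: imageP|case: (hg x Vx)].
Qed.

(** * Rules and designated elements *)

Section Designated.
Variables (L : language) (mu : set (equation L unit)).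

Definition designated (A : algebra L) (a : A) : Prop :=
  holds_all (fun=> a) mu.

Lemma holds_mu_at (A : algebra L) (v : nat -> A) (phi : formula L) :
  holds_all v (mu_at mu phi) <-> designated (eval v phi).
Proof.
split=> [H e mue|H _ [e mue <-]]; last by rewrite holds_esubst; exact: H.
by have := H _ (imageP _ mue); rewrite holds_esubst.
Qed.

Lemma holds_mu_img (A : algebra L) (v : nat -> A) (Gamma : set (formula L)) :
  holds_all v (mu_img mu Gamma) <->
  forall psi, Gamma psi -> designated (eval v psi).
Proof.
split=> [H psi Gpsi|H e [psi /H /holds_mu_at]]; last exact.
by apply/holds_mu_at => e he; apply: H; exists psi.
Qed.

Lemma designated_hom (A B : algebra L) (h : A -> B) (a : A) :
  is_hom h -> injective h -> designated (h a) <-> designated a.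
Proof. by move=> hh hi; apply: (@holds_all_hom _ _ _ _ _ (fun=> a)). Qed.

Definition satisfies (A : algebra L) (Gamma : set (formula L))
    (phi : formula L) : Prop :=
  forall v : nat -> A, (forall psi, Gamma psi -> designated (eval v psi)) ->
    designated (eval v phi).

(** [class_logic] and [logic_class] are the two halves of the Galois connection between logics and
    classes of algebras. *)
Definition class_logic (K : algebra L -> Prop) : conseq L :=
  fun Gamma phi => forall A, K A -> satisfies A Gamma phi.

Definition logic_class (Y : algebra L -> Prop) (r : conseq L) :
    algebra L -> Prop :=
  fun A => Y A /\ forall Gamma phi, r Gamma phi -> satisfies A Gamma phi.

Lemma class_logicE (K : algebra L -> Prop) Gamma phi :
  class_logic K Gamma phi <-> entails K (mu_img mu Gamma) (mu_at mu phi).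
Proof.
split=> H A KA v Hv.
  by apply/holds_mu_at; apply: H => //; apply/holds_mu_img.
by apply/holds_mu_at; apply: (H A KA); apply/holds_mu_img.
Qed.

Hypothesis mu_finite : finite_set mu.

(** Finitarity comes from compactness: [mu] at the conclusion is a finite set of equations, so
    finitely many premise equations entail it, and each comes from one premise. *)
Lemma class_logic_is_logic (K : algebra L -> Prop) :
  is_quasivariety K -> is_logic (class_logic K).
Proof.
move=> qK; split; first split.
- by move=> W a Wa A KA v; apply.
- move=> W V a WV Va A KA v Wv; apply: Va => // psi /WV; exact.
- move=> W a /class_logicE/(entails_compact qK)[].
    exact: finite_image.
  move=> V [fV /(finite_bigcup_sub (Var 0) fV)[D [fD DW VD]] KV].
  exists D; split=> //; apply/class_logicE => A KA v vD; apply: KV => // e Ve.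
  by apply: vD; apply: VD.
- move=> s W a H A KA v Wv; rewrite eval_tsubst; apply: H => // psi Wpsi.
  by rewrite -eval_tsubst; apply: Wv; exact: imageP.
Qed.

Lemma logic_class_embedding (Y : algebra L -> Prop) (r : conseq L)
    (A B : algebra L) (h : A -> B) :
  is_hom h -> injective h -> Y A -> logic_class Y r B -> logic_class Y r A.
Proof.
move=> hh hi YA [_ rB]; split=> // Gamma phi /rB HB v Hv.
apply/(designated_hom _ hh hi); rewrite (eval_hom _ _ hh); apply: HB.
by move=> psi /Hv /(designated_hom _ hh hi); rewrite (eval_hom _ _ hh).
Qed.

Lemma designated_rp (I : Type) (A : I -> algebra L) (F : set_system I)
    (a : forall i, A i) : Filter F ->
  designated (rp_pi A F a : reduced_product A F) <->
  F [set i | designated (a i)].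
Proof.
move=> FF; split=> H.
  by apply: filter_finite => // e /H /holds_rp.
move=> e mue; apply/holds_rp; apply: filterS H => i; exact.
Qed.

Lemma logic_class_quasivariety (Y : algebra L -> Prop) (r : conseq L) :
  is_quasivariety Y -> is_consequence r -> is_quasivariety (logic_class Y r).
Proof.
move=> [Yiso Ysub Yrp] cr; split.
- move=> A B AB KA; have YB := Yiso _ _ AB KA.1.
  have [h hh [g hK gK]] := AB; apply: (logic_class_embedding (h := g)) KA => //.
    move=> o b; rewrite -[RHS]hK hh; congr (g (op _)).
    by apply: funext => k; rewrite gK.
  exact: can_inj gK.
- move=> A S KA; have YS := Ysub _ S KA.1.
  apply: (logic_class_embedding (@is_hom_sval _ _ S)) KA => //.
  exact: sval_inj_sub.
- move=> I A F FF KA; split; first by apply: Yrp => i; case: (KA i).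
  (* Finitarity leaves finitely many premises, which are designated together on one member of
     [F]. *)
  move=> Gamma phi /(conseq_finitary cr)[G0 [fG0 G0G rG0]] v Hv.
  have ev psi : eval v psi =
      rp_pi A F (fun i => eval (fun n => rp_repr (v n) i) psi).
    rewrite -eval_rp; congr (eval _ psi).
    by apply: funext => n; rewrite rp_reprK.
  rewrite ev; apply/designated_rp.
  have : F [set i | forall psi, G0 psi ->
      designated (eval (fun n => rp_repr (v n) i) psi)].
    apply: filter_finite => // psi /G0G /Hv.
    by rewrite ev => /designated_rp.
  by apply: filterS => i; apply: (KA i).2 rG0 _.
Qed.

End Designated.

(** * The duality given by algebraizability *)

Section AlgebraizableLogic.
Variables (L : language) (vdash : conseq L) (Y : algebra L -> Prop).
Variables (mu : set (equation L unit)) (Delta : set (term L bool)).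
Hypothesis qY : is_quasivariety Y.
Hypothesis halg : algebraizable mu Delta vdash Y.

Lemma Lambda_class_logic (K : algebra L -> Prop) :
  Xi Y K -> Lambda vdash (class_logic mu K).
Proof.
move=> [qK KY]; split.
  exact: (class_logic_is_logic (alg_mu_finite halg) qK).
move=> W a /(alg_logic halg) H; apply/class_logicE => A KA v Hv e he.
exact: (H e he A (KY A KA)).
Qed.

Lemma Xi_logic_class (r : conseq L) :
  Lambda vdash r -> Xi Y (logic_class mu Y r).
Proof.
move=> [[cr _] _]; split; last by move=> A [].
exact: (logic_class_quasivariety (alg_mu_finite halg) qY cr).
Qed.

(** The inverse law [alg_equation_inv], read inside one algebra; it turns quasi-equations into
    rules. *)
Lemma holds_Delta (A : algebra L) (v : nat -> A) (gamma delta : formula L) :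
  Y A -> holds v (gamma, delta) <->
  forall chi, Delta_at Delta gamma delta chi -> designated mu (eval v chi).
Proof.
move=> YA; have [H1 H2] := alg_equation_inv halg gamma delta.
split=> H; last by apply: H2 => //; apply/holds_mu_img.
by apply/holds_mu_img => e he; apply: (H1 e he A YA) => _ ->.
Qed.

(** Through [Delta], every quasi-equation of [K] becomes rules of [class_logic mu K]. Models of
    these rules in [Y] satisfy the quasi-equation, so Maltsev's theorem puts them in [K]. *)
Lemma logic_classK (K : algebra L -> Prop) :
  Xi Y K -> logic_class mu Y (class_logic mu K) = K.
Proof.
move=> [qK KY]; apply: funext => A; apply: propext; split=> [[YA HA]|KA].
  apply: (quasivariety_axiomatized qK) => Theta [gamma delta] KT v vT.
  apply/(holds_Delta _ _ _ YA) => chi hchi.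
  apply: (HA (Delta_img Delta Theta)).
    move=> B KB w wT; have YB := KY B KB.
    have : holds w (gamma, delta).
      apply: KT => // -[e1 e2] Te; apply/(holds_Delta _ _ _ YB) => xi hxi.
      by apply: wT; exists (e1, e2).
    by move=> /(holds_Delta _ _ _ YB); apply.
  move=> xi [[e1 e2] /vT /(holds_Delta _ _ _ YA)]; exact.
by split=> [|Gamma phi H]; [exact: KY|exact: H].
Qed.

Section Lindenbaum.
Variables (r : conseq L) (Gamma : set (formula L)).
Hypothesis hr : Lambda vdash r.

(** The Leibniz congruence of the [r]-theory generated by [Gamma]. *)
Definition lindenbaum_rel (gamma delta : formula L) : Prop :=
  derives_all r Gamma (Delta_at Delta gamma delta).

(* Validity in [Y] transfers to [lindenbaum_rel]; in particular the congruence
   properties below need no syntactic derivation. *)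
Lemma lindenbaum_models (Theta : set (equation L nat)) (e : equation L nat)
    (s : nat -> formula L) :
  models Y Theta e ->
  (forall e, Theta e -> lindenbaum_rel (tsubst s e.1) (tsubst s e.2)) ->
  lindenbaum_rel (tsubst s e.1) (tsubst s e.2).
Proof.
have sD (gamma delta : formula L) (c : term L bool) :
    tsubst s (tsubst (fun b : bool => if b then gamma else delta) c) =
    tsubst (fun b : bool => if b then tsubst s gamma else tsubst s delta) c.
  by rewrite tsubst_comp; congr (tsubst _ c); apply: funext => -[].
case: hr => -[cr sr] vr; case: e => gamma delta.
move=> /(alg_equation halg) HD HT _ [c Dc <-] /=.
have /HD /vr /(sr s) : Delta_at Delta gamma delta
    (tsubst (fun b : bool => if b then gamma else delta) c) by exact: imageP.
rewrite sD; apply: (conseq_cut cr) => _ [_ [e Te [d Dd <-]] <-].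
by rewrite sD; apply: (HT e Te); exact: imageP.
Qed.

Lemma lindenbaum_models0 (Theta : set (equation L nat)) (e : equation L nat) :
  models Y Theta e ->
  (forall e, Theta e -> lindenbaum_rel e.1 e.2) -> lindenbaum_rel e.1 e.2.
Proof.
move=> YT HT; rewrite -(tsubst_Var e.1) -(tsubst_Var e.2).
by apply: lindenbaum_models YT _ => d /HT; rewrite !tsubst_Var.
Qed.

Lemma lindenbaum_refl a : lindenbaum_rel a a.
Proof. exact: (@lindenbaum_models0 set0 (a, a)). Qed.

Lemma lindenbaum_sym a b : lindenbaum_rel a b -> lindenbaum_rel b a.
Proof.
move=> ab; apply: (@lindenbaum_models0 [set (a, b)] (b, a)).
  by move=> A _ v /(_ (a, b) erefl).
by move=> _ ->.
Qed.

Lemma lindenbaum_trans a b c :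
  lindenbaum_rel a b -> lindenbaum_rel b c -> lindenbaum_rel a c.
Proof.
move=> ab bc; apply: (@lindenbaum_models0 [set (a, b); (b, c)] (a, c)).
  move=> A _ v H; have := H (a, b) (or_introl erefl).
  by have := H (b, c) (or_intror erefl); rewrite /holds /= => <-.
by move=> _ [->|->].
Qed.

Lemma lindenbaum_app (o : symbol L) (a b : 'I_(arity o) -> formula L) :
  (forall k, lindenbaum_rel (a k) (b k)) ->
  lindenbaum_rel (App o a) (App o b).
Proof.
move=> ab.
apply: (@lindenbaum_models0 (range (fun k => (a k, b k))) (App o a, App o b)).
  move=> A _ v H; rewrite /holds /=; congr op; apply: funext => k.
  by apply: (H (a k, b k)); exists k.
by move=> _ [k _ <-]; exact: ab.
Qed.

Let Q := formal_quotient lindenbaum_rel.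

Let evalQ := eval_fq lindenbaum_refl lindenbaum_sym lindenbaum_trans
  lindenbaum_app.
Let piQ := fq_piP lindenbaum_refl lindenbaum_sym lindenbaum_trans.

Lemma lindenbaum_val (v : nat -> Q) :
  exists s, v = fun n => fq_pi lindenbaum_rel (s n).
Proof.
by exists (fun n => fq_repr (v n)); apply: funext => n; rewrite fq_reprK.
Qed.

(** By [lindenbaum_models] the quotient satisfies the quasi-equations of [Y], which axiomatize
    [Y]. *)
Lemma lindenbaum_in_Y : Y Q.
Proof.
apply: (quasivariety_axiomatized qY) => Theta e YT v.
have [s ->] := lindenbaum_val v; rewrite /holds !evalQ => vT.
apply/piQ; apply: lindenbaum_models YT _ => d /vT.
by rewrite /holds !evalQ => /piQ.
Qed.

(** By [alg_formula_inv], [psi] is interderivable with the formulas stating that both sides of each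
    equation of [mu] at [psi] are congruent. *)
Lemma lindenbaum_designated (psi : formula L) :
  designated mu (fq_pi lindenbaum_rel psi : Q) <-> r Gamma psi.
Proof.
case: hr => -[cr sr] vr; have [H1 H2] := alg_formula_inv halg psi.
split=> [H|Gpsi e mue].
  apply: (conseq_cut cr) (vr _ _ (H2 psi erefl)) => chi [_ [e mue <-]] /=.
  by have := H e mue; rewrite /holds !evalQ => /piQ; apply.
rewrite /holds !evalQ; apply/piQ => chi hchi.
apply: (conseq_cut cr) (vr _ _ (H1 chi _)); first by move=> _ ->.
by exists (esubst (fun=> psi) e); first exact: imageP.
Qed.

Lemma lindenbaum_logic_class : logic_class mu Y r Q.
Proof.
split=> [|G phi Gphi v]; first exact: lindenbaum_in_Y.
have [s ->] := lindenbaum_val v; rewrite !evalQ => vG.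
apply/lindenbaum_designated; case: hr => -[cr sr] _.
apply: (conseq_cut cr) (sr s _ _ Gphi) => _ [psi /vG + <-].
by rewrite evalQ => /lindenbaum_designated.
Qed.

(** When each variable is sent to its class, the designated formulas are exactly the consequences of
    [Gamma], so this one model refutes whatever [r] does not derive. *)
Lemma class_logic_derives (phi : formula L) :
  class_logic mu (logic_class mu Y r) Gamma phi -> r Gamma phi.
Proof.
move=> H.
have := H Q lindenbaum_logic_class (fun n => fq_pi lindenbaum_rel (Var n)).
rewrite evalQ tsubst_Var => {}H; apply/lindenbaum_designated; apply: H.
move=> psi Gpsi; rewrite evalQ tsubst_Var; apply/lindenbaum_designated.
by case: hr => -[cr _] _; apply: (conseq_refl cr).
Qed.

End Lindenbaum.

End AlgebraizableLogic.

(** * Cores *)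

Section Core.
Variables (L : language) (f : term L unit).

Lemma eval_tapp (A : algebra L) (X : Type) (v : X -> A) (t : term L X) :
  eval v (tapp f t) = aapp f (eval v t).
Proof. by rewrite /tapp eval_tsubst. Qed.

Lemma eval_fsubst (A : algebra L) (v : nat -> A) (phi : formula L) :
  eval v (fsubst f phi) = eval (fun q => aapp f (v q)) phi.
Proof.
rewrite /fsubst eval_tsubst; congr (eval _ phi).
by apply: funext => q; rewrite eval_tapp.
Qed.

Lemma eval_fsubst_core (A : algebra L) (v : nat -> A) (phi : formula L) :
  (forall q, core f (v q)) -> eval v (fsubst f phi) = eval v phi.
Proof.
by move=> cv; rewrite eval_fsubst; congr (eval _ phi); apply: funext.
Qed.

Lemma core_sval (A : algebra L) (S : subuniverse A) (b : subalgebra S) :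
  core f b <-> core f (sval b : A).
Proof.
rewrite /core /aapp -(eval_hom (fun=> b) f (@is_hom_sval _ _ S)).
by split=> [->|/sval_inj_sub].
Qed.

(* Elements with term representations over different valuations get one over a
   common valuation, since [I * nat] embeds into [nat]. *)
Lemma eval_merge (A : algebra L) (P : A -> Prop) (I : countType) (w : I -> A) :
  (exists a, P a) ->
  (forall i, exists (v : nat -> A) (t : formula L),
     (forall q, P (v q)) /\ w i = eval v t) ->
  exists (v : nat -> A) (s : I -> formula L),
    (forall q, P (v q)) /\ forall i, w i = eval v (s i).
Proof.
move=> [a0 Pa0] hw.
have /choice[g hg] (i : I) : exists g : (nat -> A) * formula L,
    (forall q, P (g.1 q)) /\ w i = eval g.1 g.2.
  by have [v [t vt]] := hw i; exists (v, t).
(* [a0] fills the positions that code no pair. *)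
exists (fun m => if unpickle m is Some (i, n) then (g i).1 n else a0).
exists (fun i => tsubst (fun n => Var (pickle (i, n))) (g i).2).
split=> [m|i]; first by case: unpickle => [[i n]|//]; case: (hg i).
rewrite eval_tsubst (hg i).2; congr (eval _ _); apply: funext => n /=.
by rewrite pickleK.
Qed.

Section CoreSubalgebra.
Variables (A : algebra L) (coreA : exists a : A, core f a).

(** The subalgebra generated by the core; variables in [nat] suffice because a term has finitely
    many. *)
Definition core_generated (a : A) : Prop :=
  exists (v : nat -> A) (t : formula L),
    (forall q, core f (v q)) /\ a = eval v t.

Lemma core_sub_generated (a : A) : core f a -> core_generated a.
Proof. by move=> ca; exists (fun=> a), (Var 0). Qed.

Lemma core_generated_nonempty : exists a, core_generated a.
Proof. by case: coreA => a /core_sub_generated; exists a. Qed.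

Lemma core_generated_closed (o : symbol L) (a : 'I_(arity o) -> A) :
  (forall k, core_generated (a k)) -> core_generated (op a).
Proof.
move=> /(eval_merge coreA)[v [s [cv as_]]]; exists v, (App o s); split=> //=.
by congr op; apply: funext.
Qed.

Definition core_univ : subuniverse A :=
  Subuniverse core_generated_nonempty core_generated_closed.

Lemma core_superalgebra_core_univ : core_superalgebra f core_univ.
Proof.
move=> a; split=> [ca|[b cb ->]]; last by apply/core_sval.
exists (exist _ a (core_sub_generated ca) : subalgebra core_univ) => //.
exact/core_sval.
Qed.

Lemma core_univ_min (S : subuniverse A) :
  core_superalgebra f S -> forall a, core_univ a -> S a.
Proof.
move=> cS _ [v [t [cv ->]]]; apply: eval_closed => q.
by have /cS[b _ ->] := cv q; exact: (proj2_sig b).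
Qed.

End CoreSubalgebra.

Variable Y : algebra L -> Prop.
Hypothesis hfY : idempotent_in f Y.

Lemma core_aapp (A : algebra L) (a : A) : Y A -> core f (aapp f a).
Proof.
move=> YA; have := hfY 0 YA (v := fun=> a).
by rewrite /holds /= !eval_tapp; apply.
Qed.

Lemma core_nonempty (A : algebra L) : Y A -> exists a : A, core f a.
Proof.
move=> YA; case: (carrier_nonempty A) => a.
by exists (aapp f a); apply: core_aapp.
Qed.

(** The witness in [up] can be taken least, since [K] is closed under subalgebras; this choice does
    not depend on [K]. *)
Lemma upP (K : algebra L -> Prop) (A : algebra L)
    (coreA : exists a : A, core f a) :
  Xi Y K -> up f Y K A <-> Y A /\ K (subalgebra (core_univ coreA)).
Proof.
move=> [qK KY]; split=> [[YA [S [KS cS]]]|[YA KA]]; split=> //.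
  exact: (quasivariety_sub qK (core_univ_min cS)).
by exists (core_univ coreA); split=> //; apply: core_superalgebra_core_univ.
Qed.

(** * The map [QVar_f] and infima of polyatomic quasivarieties *)

Variables (vdash : conseq L) (mu : set (equation L unit)).
Variable Delta : set (term L bool).
Hypothesis qY : is_quasivariety Y.
Hypothesis halg : algebraizable mu Delta vdash Y.

Lemma QVar_f_conseq_f (r : conseq L) : Lambda vdash r ->
  QVar_f f mu Y (conseq_f f r) = up f Y (logic_class mu Y r).
Proof.
move=> hr; have XK := Xi_logic_class qY halg hr.
have [[cr sr] _] := hr.
apply: funext => A; apply: propext.
case: (pselect (Y A)) => [YA|nYA]; last by split=> -[].
have coreA := core_nonempty YA.
rewrite (upP coreA XK); split=> -[_ HA]; split=> //.
  split=> [|Gamma phi rG w wG].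
    by case: qY => _ + _; apply.
  (* [w] is a substitution [s] followed by a core assignment [v], so the rule is tested at its
     instance by [s]. *)
  have [v [s [cv ws]]] := eval_merge coreA (fun n => proj2_sig (w n)).
  pose h (x : subalgebra (core_univ coreA)) : A := sval x.
  have hh : is_hom h by exact: is_hom_sval.
  have hi : injective h by exact: sval_inj_sub.
  have hw psi : h (eval w psi) = eval v (tsubst s psi).
    rewrite (eval_hom _ _ hh) eval_tsubst; congr (eval _ psi).
    exact: funext.
  apply/(designated_hom _ _ hh hi); rewrite hw; apply/holds_mu_at.
  apply: (HA (tsubst s @` Gamma)) => //.
    (* Structurality is used for [s] and again for putting [f(q)] in place of [q]. *)
    by apply: (logic_subst hr.1); apply: sr.
  apply/holds_mu_img => _ [psi Gpsi <-]; rewrite -hw.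
  by apply/(designated_hom _ _ hh hi); apply: wG.
move=> Gamma phi rG v cv /holds_mu_img vG.
apply/holds_mu_at.
pose h (x : subalgebra (core_univ coreA)) : A := sval x.
have hh : is_hom h by exact: is_hom_sval.
have hi : injective h by exact: sval_inj_sub.
pose w n : subalgebra (core_univ coreA) :=
  exist _ (v n) (core_sub_generated (cv n)).
(* [f] fixes core values, so [psi] may be replaced by [fsubst f psi], the form that [rG] needs. *)
have hw psi : eval v psi = h (eval w (fsubst f psi)).
  by rewrite -(eval_fsubst_core psi cv) (eval_hom _ _ hh).
rewrite hw; apply/(designated_hom _ _ hh hi).
apply: (HA.2 _ _ rG) => _ [psi Gpsi <-].
by apply/(designated_hom _ _ hh hi); rewrite -hw; apply: vG.
Qed.

Lemma QVar_f_reflects (r : conseq L) (Gamma : set (formula L))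
    (phi : formula L) :
  Lambda_f f vdash r ->
  (forall A, QVar_f f mu Y r A -> models_f f mu A Gamma phi) -> r Gamma phi.
Proof.
move=> [t ht ->] H; apply: (class_logic_derives qY halg ht) => A [YA tA] v vG.
rewrite eval_fsubst; apply/holds_mu_at.
(* [H] is applied to [A] with [f] composed after [v], a core assignment by idempotence. *)
apply: H => [|p|]; last 1 first.
- apply/holds_mu_img => psi Gpsi; rewrite -eval_fsubst; apply: vG.
  exact: imageP.
- split=> // G p tG w cw /holds_mu_img wG; apply/holds_mu_at.
  rewrite -(eval_fsubst_core p cw); apply: (tA _ _ tG) => _ [psi Gpsi <-].
  by rewrite eval_fsubst_core //; apply: wG.
- exact: core_aapp.
Qed.

Lemma QVar_f_le (r s : conseq L) :
  Lambda_f f vdash s ->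
  conseq_le r s <-> class_le (QVar_f f mu Y s) (QVar_f f mu Y r).
Proof.
move=> hs; split=> [rs A [YA sA]|H G phi rG].
  by split=> // G phi /rs /sA.
by apply: (QVar_f_reflects hs) => A /H [_]; apply.
Qed.

(** By [upP], membership in each [up f Y M] is tested on the same core-generated subalgebra, so [up]
    commutes with intersections. *)
Lemma Xi_f_glb (X : (algebra L -> Prop) -> Prop) :
  (forall U, X U -> Xi_f f Y U) ->
  exists U, is_glb (@class_le L) (Xi_f f Y) X U.
Proof.
move=> XX.
(* All [M] with [up f Y M] in [X] are intersected, so none has to be chosen; the conjunct [Y A]
   covers empty [X]. *)
pose K A := Y A /\ forall M, Xi Y M -> X (up f Y M) -> M A.
have XK : Xi Y K.
  split; last by move=> A [].
  have [Yiso Ysub Yrp] := qY; split.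
  - move=> A B AB [YA KA]; split=> [|M XM XuM]; first exact: Yiso YA.
    by have [[Miso _ _] _] := XM; apply: Miso AB (KA M XM XuM).
  - move=> A S [YA KA]; split=> [|M XM XuM]; first exact: Ysub.
    by have [[_ Msub _] _] := XM; apply: Msub (KA M XM XuM).
  - move=> I A F FF KA; split=> [|M XM XuM].
      by apply: Yrp => i; case: (KA i).
    by have [[_ _ Mrp] _] := XM; apply: Mrp => i; apply: (KA i).2.
exists (up f Y K); split; first by exists K.
  move=> U XU; have [M XM UM] := XX U XU; subst U => A UA.
  have coreA := core_nonempty UA.1.
  have /(upP coreA XK)[YA [_ KA]] := UA.
  by apply/(upP coreA XM); split=> //; apply: KA.
move=> _ [N XN ->] UN A NA; have YA := NA.1.
have coreA := core_nonempty YA.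
apply/(upP coreA XK); split=> //; split.
  by case: qY => _ + _; apply.
by move=> M XM XuM; have /(upP coreA XM)[] := UN _ XuM A NA.
Qed.

End Core.

(** * Order, completeness and the final assembly *)

Lemma conseq_le_partial_order (L : language) (D : conseq L -> Prop) :
  partial_order_on (@conseq_le L) D.
Proof.
split=> [r _ W a //|r s _ _ rs sr|r s t _ _ _ rs st W a /rs /st //].
by apply: funext => W; apply: funext => a; apply: propext; split=> [/rs|/sr].
Qed.

Lemma class_le_partial_order (L : language)
    (D : (algebra L -> Prop) -> Prop) :
  partial_order_on (@class_le L) D.
Proof.
split=> [K _ A //|K M _ _ KM MK|K M N _ _ _ KM MN A /KM /MN //].
by apply: funext => A; apply: propext; split=> [/KM|/MK].
Qed.

Lemma complete_lattice_of_glb (T : Type) (le : T -> T -> Prop)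
    (D : T -> Prop) :
  partial_order_on le D ->
  (forall X : T -> Prop, (forall x, X x -> D x) -> exists m, is_glb le D X m) ->
  complete_lattice_on le D.
Proof.
move=> po glb; split=> // X XD; split; first exact: glb.
have [|m [Dm lem gem]] := glb (fun z => D z /\ forall x, X x -> le x z).
  by move=> z [].
exists m; split=> // [x Xx|z Dz Xz]; last exact: lem.
by apply: gem => [|z [_]]; [exact: XD|apply].
Qed.

(** Suprema in [E] pull back to infima in [D], so meets of polyatomic logics need no direct
    construction. *)
Lemma dual_isomorphism_complete (S T : Type) (leS : S -> S -> Prop)
    (leT : T -> T -> Prop) (D : S -> Prop) (E : T -> Prop) (h : S -> T) :
  dual_isomorphism leS leT D E h -> partial_order_on leS D ->
  complete_lattice_on leT E -> complete_lattice_on leS D.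
Proof.
move=> [hDE _ hsurj hle] po [_ cE]; apply: complete_lattice_of_glb => // X XD.
have [|_ [m [Em mub mlub]]] := cE (fun z => exists2 x, X x & h x = z).
  by move=> _ [x /XD /hDE + <-].
have [x Dx hx] := hsurj m Em; rewrite -{}hx in Em mub mlub.
exists x; split=> // [y Xy|y Dy yX].
  by apply/hle => //; [exact: XD|apply: mub; exists y].
apply/hle => //; apply: mlub => [|_ [w Xw <-]]; first exact: hDE.
by apply/hle => //; [exact: XD|exact: yX].
Qed.

Theorem corollary3p27 (L : language) (vdash : conseq L)
    (Y : algebra L -> Prop) (mu : set (equation L unit))
    (Delta : set (term L bool)) (f : term L unit)
    (hlogic : is_logic vdash)
    (hY : is_quasivariety Y)
    (halg : algebraizable mu Delta vdash Y)
    (hf : selector_term f vdash)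
    (hfY : idempotent_in f Y) :
  [/\ complete_lattice_on (@conseq_le L) (Lambda_f f vdash),
      complete_lattice_on (@class_le L) (Xi_f f Y)
    & dual_isomorphism (@conseq_le L) (@class_le L)
        (Lambda_f f vdash) (Xi_f f Y) (QVar_f f mu Y)].
Proof.
have cXi : complete_lattice_on (@class_le L) (Xi_f f Y).
  apply: complete_lattice_of_glb; first exact: class_le_partial_order.
  by move=> X; apply: Xi_f_glb.
have iso : dual_isomorphism (@conseq_le L) (@class_le L)
    (Lambda_f f vdash) (Xi_f f Y) (QVar_f f mu Y).
  have QE t : Lambda vdash t ->
      QVar_f f mu Y (conseq_f f t) = up f Y (logic_class mu Y t).
    exact: (QVar_f_conseq_f hfY hY halg).
  have le := QVar_f_le hfY hY halg.
  split.
  - move=> _ [t ht ->]; exists (logic_class mu Y t); last exact: QE.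
    exact: (Xi_logic_class hY halg ht).
  (* Injectivity follows from order reflection and antisymmetry. *)
  - move=> r s hr hs rs.
    have [_ anti _] := conseq_le_partial_order (Lambda_f f vdash).
    by apply: anti => //; [apply/(le r s hs)|apply/(le s r hr)]; rewrite rs.
  - move=> _ [K XK ->]; have ht := Lambda_class_logic halg XK.
    exists (conseq_f f (class_logic mu K)); first by exists (class_logic mu K).
    by rewrite QE // (logic_classK halg XK).
  - by move=> r s _ hs; exact: le.
split=> //; apply: dual_isomorphism_complete iso _ cXi.
exact: conseq_le_partial_order.
Qed.
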